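(* Let $N\ge1$ and consider the network $\mathcal I(T(\Sigma_1),\ldots,T(\Sigma_N))$ of transition systems associated with switched subsystems $\Sigma_1,\dots,\Sigma_N$ with neighbour sets $\mathcal N_i$. Assume each $T(\Sigma_i)$ and its finite abstraction $T(\hat\Sigma_i)$ admit a local InitSOPSF $\mathcal V_i$ of the form $\mathcal V_i((x_i,p_i,l_i),(\hat x_i,p_i,l_i))=V_{i,p_i}(x_i,\hat x_i)\kappa_{i,p_i}^{-l_i/\epsilon_i}$, with associated constant $\kappa_i\in(0,1)$ and functions $\alpha_i,\rho_i,\hat\gamma_i,\overline\alpha_i\in\mathcal K_\infty$ (all as defined in the context). For $i,j\in\{1,\dots,N\}$ define $$\gamma_{ij}:=\begin{cases}(1-\kappa_i)^{-1}\rho_i\circ\alpha_j^{-1}&\text{if }j\in\mathcal N_i,\\0&\text{otherwise,}\end{cases}$$ and assume the small-gain condition $$\gamma_{i_1i_2}\circ\gamma_{i_2i_3}\circ\cdots\circ\gamma_{i_{r-1}i_r}\circ\gamma_{i_ri_1}<\mathcal I_d\qquad\forall(i_1,\dots,i_r)\in\{1,\dots,N\}^r,\ r\in\{1,\dots,N\}.$$ Then for every desired precision $\varepsilon>0$ there exist local quantization parameters $\eta_i>0$ and $\phi_{ij}>0$ designed as follows: there are functions $\sigma_i\in\mathcal K_\infty$ with $\max_{j\in\mathcal N_i}\{\gamma_{ij}\circ\sigma_j\}<\sigma_i$ for all $i$, a number $r>0$ with $\max_i\sigma_i(r)=\varepsilon$, and, setting $\varepsilon_i=\sigma_i(r)$,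 parameters $\phi_{ij}>0$ with $$\max_{j\in\mathcal N_i}\phi_{ij}<\rho_i^{-1}((1-\kappa_i)\varepsilon_i)-\max_{j\in\mathcal N_i}\alpha_j^{-1}(\varepsilon_j)\quad\forall i,$$ and, setting $\vartheta_i=\max_{j\in\mathcal N_i}\{\alpha_j^{-1}(\varepsilon_j)+\phi_{ij}\}$, parameters $\eta_i>0$, such that the following two conditions hold simultaneously: $$\alpha_j^{-1}(\varepsilon_j)+\phi_{ij}\le\vartheta_i\quad\forall i\in\{1,\dots,N\},\ \forall j\in\mathcal N_i,$$ $$\eta_i\le\min\{\hat\gamma_i^{-1}((1-\kappa_i)\varepsilon_i-\rho_i(\vartheta_i)),\ \overline\alpha_i^{-1}(\varepsilon_i)\}\quad\forall i\in\{1,\dots,N\}.$$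
   Context: $\mathcal K_\infty$ is the set of continuous, strictly increasing, unbounded functions $\alpha:\mathbb R_{\ge0}\to\mathbb R_{\ge0}$ with $\alpha(0)=0$; $\mathcal I_d$ is the identity on $\mathbb R_{\ge0}$. Strict inequality $f<g$ between such functions (or the zero function) means $f(s)<g(s)$ for all $s>0$. $\|\cdot\|$ is the infinity norm. A maximum over an empty index set is $0$. Subsystems. Each $\Sigma_i=(\mathbb X_i,\mathbb X_{0_i},\mathbb X_{s_i},P_i,\mathbb W_i,F_i,\mathbb Y_i,h_i)$ is a deterministic discrete-time switched system: state, initial state and secret sets $\mathbb X_i,\mathbb X_{0_i},\mathbb X_{s_i}\subseteq\mathbb R^{n_i}$, finite mode set $P_i$, internal input set $\mathbb W_i$, output set $\mathbb Y_i$, maps $f_{i,p}:\mathbb X_i\times\mathbb W_i\to\mathbb X_i$ ($p\in P_i$), output map $h_i:\mathbb X_i\to\mathbb Y_i$ with $\|h_i(x)-h_i(y)\|\le\ell_i(\|x-y\|)$ for some $\ell_i\in\mathcal K_\infty$, and dwell time $k_{d,i}\in\mathbb N_{\ge1}$; $\mathbb X_i,\mathbb W_i$ are finite unions of boxes. Outputs and internal inputs are partitioned as $h_i(x_i)=[h_{i1}(x_i);\dots;h_{iN}(x_i)]$, $w_i=[w_{ij}]_{j\ne i}$; $\mathcal N_i=\{j\ne i\mid h_{ji}\not\equiv0\}$ is the set of subsystems feeding subsystem $i$, and in the network $w_{ij}=h_{ji}(x_j)$ for $j\in\mathcal N_i$. The associated transition system is $T(\Sigma_i)=(X_i,X_{0_i},X_{s_i},U_i,W_i,\mathcal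 F_i,Y_i,\mathcal H_i)$ with $X_i=\mathbb X_i\times P_i\times\{0,\dots,k_{d,i}-1\}$, $X_{0_i}=\mathbb X_{0_i}\times P_i\times\{0\}$, $X_{s_i}=\mathbb X_{s_i}\times P_i\times\{0,\dots,k_{d,i}-1\}$, $U_i=P_i$, $W_i=\mathbb W_i$, $Y_i=\mathbb Y_i$, $\mathcal H_i(x,p,l)=h_i(x)$, and $(x^+,p^+,l^+)\in\mathcal F_i((x,p,l),u,w)$ iff $x^+=f_{i,p}(x,w)$, $u=p$, and one of: ($l<k_{d,i}-1$, $p^+=p$, $l^+=l+1$); ($l=k_{d,i}-1$, $p^+=p$, $l^+=k_{d,i}-1$); ($l=k_{d,i}-1$, $p^+\ne p$, $l^+=0$). Finite abstraction. For a set $S$ and $\eta>0$, $[S]_\eta=\{a\in S\mid a_j=k_j\eta,\ k_j\in\mathbb Z\}$. $T(\hat\Sigma_i)$ has $\hat X_i=[\mathbb X_i]_{\eta_i}\times P_i\times\{0,\dots,k_{d,i}-1\}$, $\hat X_{0_i}=[\mathbb X_{0_i}]_{\eta_i}\times P_i\times\{0\}$, $\hat X_{s_i}=[\mathbb X_{s_i}]_{\eta_i}\times P_i\times\{0,\dots,k_{d,i}-1\}$, $\hat U_i=P_i$, $\hat W_i=\prod_{j\ne i}[\mathbb W_{ij}]_{\phi_{ij}}$, the same transition rule as $T(\Sigma_i)$ but with $x^+=f_{i,p}(x,w)$ replaced by $\|f_{i,p}(\hat x,\hat w)-\hat x^+\|\le\eta_i$, $\hat{\mathcal H}_i(\hat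 x,p,l)=h_i(\hat x)$, and $\hat Y_i=\hat{\mathcal H}_i(\hat X_i)$; $\eta_i$ is the state and $\phi_{ij}$ the internal input quantization parameter. Lyapunov data. For each $i$ and $p\in P_i$ there are $V_{i,p}:\mathbb X_i\times\mathbb X_i\to\mathbb R_{\ge0}$, $\underline\alpha_{i,p},\overline\alpha_{i,p},\rho_{i,p}\in\mathcal K_\infty$ and $0<\kappa_{i,p}<1$ with $\underline\alpha_{i,p}(\|x-\hat x\|)\le V_{i,p}(x,\hat x)\le\overline\alpha_{i,p}(\|x-\hat x\|)$ and $V_{i,p}(f_{i,p}(x,w),f_{i,p}(\hat x,\hat w))\le\kappa_{i,p}V_{i,p}(x,\hat x)+\rho_{i,p}(\|w-\hat w\|)$ for all $x,\hat x\in\mathbb X_i$, $w,\hat w\in\mathbb W_i$; there is $\mu_i\ge1$ with $V_{i,p}\le\mu_iV_{i,q}$ for all $p,q\in P_i$; there are $\gamma_{i,p}\in\mathcal K_\infty$ with $V_{i,p}(x,y)\le V_{i,p}(x,z)+\gamma_{i,p}(\|y-z\|)$ for all $x,y,z\in\mathbb X_i$; and, for a fixed $\epsilon_i>1$, $k_{d,i}\ge\epsilon_i\ln\mu_i/\ln(1/\kappa_{i,p})+1$ for all $p\in P_i$. The associated data are $$\kappa_i=\max_{p\in P_i}\kappa_{i,p}^{\frac{\epsilon_i-1}{\epsilon_i}},\ \ \rho_i=\max_{p\in P_i}\kappa_{i,p}^{-\frac{k_{d,i}}{\epsilon_i}}\rho_{i,p},\ \ \hat\gamma_i=\max_{p\in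 P_i}\kappa_{i,p}^{-\frac{k_{d,i}}{\epsilon_i}}\gamma_{i,p},\ \ \overline\alpha_i=\max_{p\in P_i}\overline\alpha_{i,p},\ \ \alpha_i=\Big(\max_{p\in P_i}\ell_i\circ\underline\alpha_{i,p}^{-1}\Big)^{-1}$$ (pointwise maxima). Local InitSOPSF. For $\bar\varepsilon\ge0$, $\mathcal S_i$ is a local $\bar\varepsilon$-InitSOPSF from $T(\Sigma_i)$ to $T(\hat\Sigma_i)$ if for some $\vartheta\ge0$, $\alpha\in\mathcal K_\infty$: 1(a) $\forall z^0\in X_{0_i}\cap X_{s_i}$ $\exists\hat z^0\in\hat X_{0_i}\cap\hat X_{s_i}$ with $\mathcal S_i(z^0,\hat z^0)\le\bar\varepsilon$; 1(b) $\forall\hat z^0\in\hat X_{0_i}\setminus\hat X_{s_i}$ $\exists z^0\in X_{0_i}\setminus X_{s_i}$ with $\mathcal S_i(z^0,\hat z^0)\le\bar\varepsilon$; 2. $\alpha(\|\mathcal H_i(z)-\hat{\mathcal H}_i(\hat z)\|)\le\mathcal S_i(z,\hat z)$ for all $z,\hat z$; 3. whenever $\mathcal S_i(z,\hat z)\le\bar\varepsilon$ and $\|w-\hat w\|\le\vartheta$ ($w\in W_i,\hat w\in\hat W_i$): (a) $\forall u$, $\forall z^+\in\mathcal F_i(z,u,w)$, $\exists\hat u$, $\exists\hat z^+\in\hat{\mathcal F}_i(\hat z,\hat u,\hat w)$ with $\mathcal S_i(z^+,\hat z^+)\le\bar\varepsilon$, and (b) $\forall\hat u$, $\forall\hat z^+\in\hat{\mathcal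 F}_i(\hat z,\hat u,\hat w)$, $\exists u$, $\exists z^+\in\mathcal F_i(z,u,w)$ with $\mathcal S_i(z^+,\hat z^+)\le\bar\varepsilon$. For $\mathcal V_i$, which is defined on pairs sharing the same $(p,l)$, these conditions are understood over such pairs. In the hypothesis of the claim, the precision of the local InitSOPSF $\mathcal V_i$ is some nonnegative number; the $\varepsilon_i$ in the conclusion are those defined there by $\varepsilon_i=\sigma_i(r)$. *)

(* Defs.v *)
From HB Require Import structures.
From mathcomp Require Export all_boot all_order all_algebra.
From mathcomp Require Export all_classical all_reals all_analysis.

Set Implicit Arguments.
Unset Strict Implicit.
Unset Printing Implicit Defensive.

Import Order.TTheory GRing.Theory Num.Theory.
Import numFieldNormedType.Exports.

Local Open Scope classical_set_scope.
Local Open Scope ring_scope.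

(* Functions on the nonnegative reals are represented by functions R -> R of
   which only the restriction to [0, +oo[ matters. *)

Definition Kinf (R : realType) (f : R -> R) : Prop :=
  [/\ f 0 = 0,
      {within (`[0, +oo[ : set R), continuous f},
      forall s t, 0 <= s -> s < t -> f s < f t
    & forall M, exists2 s, 0 <= s & M < f s].

Definition Kinv (R : realType) (f : R -> R) : R -> R := pinv (`[0, +oo[ : set R) f.

Definition fun_lt (R : realType) (f g : R -> R) : Prop :=
  forall s, 0 < s -> f s < g s.

(* A stacked vector [v_j]_(j : J), given by its blocks v_j in R^(d j). *)
Definition stacked (R : realType) (J : finType) (d : J -> nat) : Type :=
  forall j : J, 'rV[R]_(d j).

(* The infinity norm of v - w; the norm of 'rV[R]_n is the infinity norm. *)
Definition sdist (R : realType) (J : finType) (d : J -> nat)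
    (v w : stacked R d) : R :=
  \big[Num.max/0]_(j : J) `|v j - w j|.

Definition box (R : realType) (n : nat) (a b : 'rV[R]_n) : set 'rV[R]_n :=
  [set x | forall k, a 0 k <= x 0 k <= b 0 k].

Definition union_of_boxes (R : realType) (n : nat) (S : set 'rV[R]_n) : Prop :=
  exists s : seq ('rV[R]_n * 'rV[R]_n),
    S = \bigcup_(ab in [set` s]) box ab.1 ab.2.

Definition stacked_union_of_boxes (R : realType) (J : finType) (d : J -> nat)
    (S : set (stacked R d)) : Prop :=
  exists M (a b : 'I_M -> stacked R d),
    S = [set w | exists m, forall j, box (a m j) (b m j) (w j)].

Definition stacked_prod (R : realType) (J : finType) (d : J -> nat)
    (S : forall j, set 'rV[R]_(d j)) : set (stacked R d) :=
  [set w | forall j, S j (w j)].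

Definition grid (R : realType) (n : nat) (S : set 'rV[R]_n) (eta : R) :
    set 'rV[R]_n :=
  [set a | S a /\ forall j, exists k : int, a 0 j = k%:~R * eta].

(* J indexes the blocks of the internal input, K those of the output. The maps
   dyn, out are total, and constrained on the state and input sets only. *)
Record switched_system (R : realType) (J K : finType)
    (din : J -> nat) (dout : K -> nat) := SwitchedSystem {
  dim : nat;
  St : set 'rV[R]_dim;
  St0 : set 'rV[R]_dim;
  Secret : set 'rV[R]_dim;
  mode : finType;
  Win : forall j, set 'rV[R]_(din j);
  dyn : mode -> 'rV[R]_dim -> stacked R din -> 'rV[R]_dim;
  Out : set (stacked R dout);
  out : 'rV[R]_dim -> stacked R dout;
  dwell : nat;
  ell : R -> R;
  mode_gt0 : (0 < #|mode|)%N;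
  St_boxes : union_of_boxes St;
  Win_boxes : stacked_union_of_boxes (stacked_prod Win);
  dynP : forall p x w, St x -> stacked_prod Win w -> St (dyn p x w);
  outP : forall x, St x -> Out (out x);
  dwell_gt0 : (0 < dwell)%N;
  ell_Kinf : Kinf ell;
  out_ell : forall x y, St x -> St y -> sdist (out x) (out y) <= ell `|x - y|
}.

Arguments St {R J K din dout} s _.
Arguments St0 {R J K din dout} s _.
Arguments Secret {R J K din dout} s _.
Arguments Win {R J K din dout} s j _.

Record transition_system (R : realType) (J K : finType) (din : J -> nat)
    (dout : K -> nat) (X U : Type) := TransitionSystem {
  tsX : set X;
  tsX0 : set X;
  tsXs : set X;
  tsU : set U;
  tsW : set (stacked R din);
  tsF : X -> U -> stacked R din -> set X;
  tsY : set (stacked R dout);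
  tsH : X -> stacked R dout
}.

Definition ts_state (R : realType) (J K : finType) (din : J -> nat)
    (dout : K -> nat) (S : switched_system R din dout) : Type :=
  ('rV[R]_(dim S) * mode S * 'I_(dwell S))%type.

Definition mode_step (P : finType) (kd : nat) (p p' : P) (l l' : 'I_kd) : Prop :=
  [\/ [/\ (l < kd.-1)%N, p' = p & l' = l.+1 :> nat],
      [/\ l = kd.-1 :> nat, p' = p & l' = kd.-1 :> nat]
    | [/\ l = kd.-1 :> nat, p' <> p & l' = 0%N :> nat]].

Definition ts_of (R : realType) (J K : finType) (din : J -> nat)
    (dout : K -> nat) (S : switched_system R din dout) :
    transition_system R din dout (ts_state S) (mode S) :=
  {| tsX := [set z : ts_state S | St S z.1.1];
     tsX0 := [set z : ts_state S | St0 S z.1.1 /\ z.2 = 0%N :> nat];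
     tsXs := [set z : ts_state S | Secret S z.1.1];
     tsU := setT;
     tsW := stacked_prod (Win S);
     tsF := fun (z : ts_state S) u w => [set z' : ts_state S |
       [/\ z'.1.1 = dyn z.1.2 z.1.1 w, u = z.1.2
         & mode_step z.1.2 z'.1.2 z.2 z'.2]];
     tsY := Out S;
     tsH := fun z : ts_state S => out z.1.1 |}.

(* Successors are taken in the quantized state set. *)
Definition abstraction (R : realType) (J K : finType) (din : J -> nat)
    (dout : K -> nat) (S : switched_system R din dout)
    (eta : R) (phi : J -> R) :
    transition_system R din dout (ts_state S) (mode S) :=
  let X := [set z : ts_state S | grid (St S) eta z.1.1] in
  let H := fun z : ts_state S => out z.1.1 in
  {| tsX := X;
     tsX0 := [set z : ts_state S | grid (St0 S) eta z.1.1 /\ z.2 = 0%N :> nat];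
     tsXs := [set z : ts_state S | grid (Secret S) eta z.1.1];
     tsU := setT;
     tsW := stacked_prod (fun j => grid (Win S j) (phi j));
     tsF := fun (z : ts_state S) u w => [set z' : ts_state S |
       [/\ X z', `|dyn z.1.2 z.1.1 w - z'.1.1| <= eta, u = z.1.2
         & mode_step z.1.2 z'.1.2 z.2 z'.2]];
     tsY := H @` X;
     tsH := H |}.

(* The function SF is only considered on the pairs related by D. *)
Definition local_InitSOPSF (R : realType) (J K : finType) (din : J -> nat)
    (dout : K -> nat) (X X' U U' : Type)
    (T : transition_system R din dout X U)
    (T' : transition_system R din dout X' U')
    (D : X -> X' -> Prop) (prec : R) (SF : X -> X' -> R) : Prop :=
  exists (vtheta : R) (alpha : R -> R), [/\ 0 <= vtheta, Kinf alpha &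
  [/\ forall z, (tsX0 T `&` tsXs T) z ->
        exists z', [/\ (tsX0 T' `&` tsXs T') z', D z z' & SF z z' <= prec],
      forall z', (tsX0 T' `\` tsXs T') z' ->
        exists z, [/\ (tsX0 T `\` tsXs T) z, D z z' & SF z z' <= prec],
      forall z z', tsX T z -> tsX T' z' -> D z z' ->
        alpha (sdist (tsH T z) (tsH T' z')) <= SF z z'
    & forall z z' w w', tsX T z -> tsX T' z' -> D z z' -> SF z z' <= prec ->
        tsW T w -> tsW T' w' -> sdist w w' <= vtheta ->
        (forall u z1, tsU T u -> tsF T z u w z1 ->
           exists u' z1', [/\ tsU T' u', tsF T' z' u' w' z1',
                              D z1 z1' & SF z1 z1' <= prec]) /\
        (forall u' z1', tsU T' u' -> tsF T' z' u' w' z1' ->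
           exists u z1, [/\ tsU T u, tsF T z u w z1,
                            D z1 z1' & SF z1 z1' <= prec])]].

Record lyapunov_data (R : realType) (J K : finType) (din : J -> nat)
    (dout : K -> nat) (S : switched_system R din dout) := LyapunovData {
  V : mode S -> 'rV[R]_(dim S) -> 'rV[R]_(dim S) -> R;
  alow : mode S -> R -> R;
  aup : mode S -> R -> R;
  rhop : mode S -> R -> R;
  kappap : mode S -> R;
  mu : R;
  gammap : mode S -> R -> R;
  leps : R;
  alow_Kinf : forall p, Kinf (alow p);
  aup_Kinf : forall p, Kinf (aup p);
  rhop_Kinf : forall p, Kinf (rhop p);
  gammap_Kinf : forall p, Kinf (gammap p);
  kappap_itv : forall p, 0 < kappap p < 1;
  V_bounds : forall p x y, St S x -> St S y ->
    alow p `|x - y| <= V p x y <= aup p `|x - y|;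
  V_dyn : forall p x y w v, St S x -> St S y ->
    stacked_prod (Win S) w -> stacked_prod (Win S) v ->
    V p (dyn p x w) (dyn p y v) <= kappap p * V p x y + rhop p (sdist w v);
  mu_ge1 : 1 <= mu;
  V_mu : forall p q x y, St S x -> St S y -> V p x y <= mu * V q x y;
  V_gamma : forall p x y z, St S x -> St S y -> St S z ->
    V p x y <= V p x z + gammap p `|y - z|;
  leps_gt1 : 1 < leps;
  dwell_leps : forall p,
    leps * ln mu / ln (1 / kappap p) + 1 <= (dwell S)%:R
}.

(* Data associated with the Lyapunov data L of S; the maxima range over a
   nonempty set of nonnegative numbers, so the default value 0 is harmless. *)

Definition akappa (R : realType) (J K : finType) (din : J -> nat)
    (dout : K -> nat) (S : switched_system R din dout)
    (L : lyapunov_data S) : R :=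
  \big[Num.max/0]_(p : mode S) (kappap L p `^ ((leps L - 1) / leps L)).

Definition arho (R : realType) (J K : finType) (din : J -> nat)
    (dout : K -> nat) (S : switched_system R din dout)
    (L : lyapunov_data S) (s : R) : R :=
  \big[Num.max/0]_(p : mode S)
    (kappap L p `^ (- ((dwell S)%:R / leps L)) * rhop L p s).

Definition agammahat (R : realType) (J K : finType) (din : J -> nat)
    (dout : K -> nat) (S : switched_system R din dout)
    (L : lyapunov_data S) (s : R) : R :=
  \big[Num.max/0]_(p : mode S)
    (kappap L p `^ (- ((dwell S)%:R / leps L)) * gammap L p s).

Definition aalphaup (R : realType) (J K : finType) (din : J -> nat)
    (dout : K -> nat) (S : switched_system R din dout)
    (L : lyapunov_data S) (s : R) : R :=
  \big[Num.max/0]_(p : mode S) aup L p s.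

Definition aalpha (R : realType) (J K : finType) (din : J -> nat)
    (dout : K -> nat) (S : switched_system R din dout)
    (L : lyapunov_data S) : R -> R :=
  Kinv (fun s => \big[Num.max/0]_(p : mode S) ell S (Kinv (alow L p) s)).

Definition Vcal (R : realType) (J K : finType) (din : J -> nat)
    (dout : K -> nat) (S : switched_system R din dout)
    (L : lyapunov_data S) (z z' : ts_state S) : R :=
  V L z.1.2 z.1.1 z'.1.1 * kappap L z.1.2 `^ (- (z.2%:R / leps L)).

Definition same_mode (R : realType) (J K : finType) (din : J -> nat)
    (dout : K -> nat) (S : switched_system R din dout)
    (z z' : ts_state S) : Prop :=
  z.1.2 = z'.1.2 /\ z.2 = z'.2.
Arguments same_mode {R J K din dout} S z z'.

Definition others (N : nat) (i : 'I_N) : finType := {j : 'I_N | j != i}.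

Definition out_nonzero (R : realType) (J K : finType) (din : J -> nat)
    (dout : K -> nat) (S : switched_system R din dout) (k : K) : Prop :=
  exists2 x, St S x & out x k != 0.

(* The network of the subsystems sub i: the j-th internal input w_ij of sub i
   is the i-th output block h_ji(x_j) of sub j. *)
Record network (R : realType) (N : nat) := Network {
  ydim : 'I_N -> 'I_N -> nat;
  sub : forall i : 'I_N,
    switched_system R (fun j : others i => ydim (val j) i) (ydim i);
  wired : forall (i : 'I_N) (j : others i), out_nonzero (sub (val j)) i ->
    forall x, St (sub (val j)) x -> Win (sub i) j (out x i)
}.

Definition nbr (R : realType) (N : nat) (Net : network R N) (i j : 'I_N) : bool :=
  (j != i) && `[< out_nonzero (sub Net j) i >].

Definition gain (R : realType) (N : nat) (Net : network R N)
    (L : forall i, lyapunov_data (sub Net i)) (i j : 'I_N) : R -> R :=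
  if nbr Net i j then
    fun s => (1 - akappa (L i))^-1 * arho (L i) (Kinv (aalpha (L j)) s)
  else fun=> 0.

(* For c = (i_1, ..., i_r), r >= 1, the list of pairs zip c (rot 1 c) is
   (i_1, i_2), ..., (i_(r-1), i_r), (i_r, i_1). *)
Definition cycle_gain (R : realType) (N : nat) (Net : network R N)
    (L : forall i, lyapunov_data (sub Net i)) (c : seq 'I_N) : R -> R :=
  \big[comp/id]_(e <- zip c (rot 1 c)) gain L e.1 e.2.

(* Main.v *)
(* The heart is the construction of sigma_i in Kinf with gamma_ij \o sigma_j <
   sigma_i. The small-gain condition on simple cycles extends to all closed
   walks, by cutting out cycles, and the sigma_i are then found one at a time by
   eliminating nodes. Since max_i sigma_i is in Kinf, it takes the value eps at
   some r > 0; at r the strict inequalities say that alpha_j^-1(eps_j) <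
   rho_i^-1((1 - kappa_i) eps_i), which leaves room for phi_ij, and then for
   eta_i. *)

Require Import Defs.
From mathcomp Require Import zify lra.

Set Implicit Arguments.
Unset Strict Implicit.
Unset Printing Implicit Defensive.

Import Order.TTheory GRing.Theory Num.Theory.
Import numFieldNormedType.Exports.

Local Open Scope classical_set_scope.
Local Open Scope ring_scope.

(** * Functions of class K-infinity and their inverses *)

(** For increasing functions surjectivity onto the nonnegative reals replaces continuity and
    unboundedness; it is checked for inverses, compositions and maxima by exhibiting a preimage. *)
Lemma KinfP (R : realType) (f : R -> R) : Kinf f <->
  [/\ f 0 = 0, forall s t, 0 <= s -> s < t -> f s < f t
    & forall y, 0 <= y -> exists2 x, 0 <= x & f x = y].
Proof.
split=> [[f0 fc fi fu]|[f0 fi fs]].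
  split=> // y y0; have [s s0 ys] := fu y.
  have cs : {within `[0, s], continuous f}.
    apply: continuous_subspaceW fc => x /=.
    by rewrite !in_itv/= andbT => /andP[].
  have fs0 : 0 <= f s by apply: le_trans y0 (ltW ys).
  have [|c] := IVT s0 cs (v := y).
    by rewrite f0 min_l// max_r// y0 ltW.
  by rewrite in_itv/= => /andP[c0 _] fc'; exists c.
have fle s t : 0 <= s -> s <= t -> f s <= f t.
  by move=> s0; rewrite le_eqVlt => /predU1P[->//|st]; exact/ltW/fi.
split=> //; last first.
  move=> M; have [|x x0 fx] := fs (`|M| + 1); first by rewrite addr_ge0.
  by exists x => //; rewrite fx (le_lt_trans (ler_norm _))// ltrDl.
(* An increasing map of [[0, b]] onto [[0, f b]] has no jump. *)
have cb b : 0 < b -> {within `[0, b], continuous f}.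
  move=> b0; apply: segment_inc_surj_continuous.
    move=> x y; rewrite !in_itv/= => /andP[x0 _] /andP[y0 _].
    apply/idP/idP => [|xy]; last exact: fle.
    by case: (leP x y) => // /(fi _ _ y0) yx; rewrite leNgt yx.
  move=> y /=; rewrite in_itv/= f0 => /andP[y0 yb].
  have [x x0 fx] := fs _ y0; exists x => //=.
  rewrite in_itv/= x0/= leNgt; apply/negP => bx.
  by have := fi _ _ (ltW b0) bx; rewrite fx ltNge yb.
apply/continuous_within_itvcyP; split.
  move=> x; rewrite in_itv/= andbT => x0.
  have x10 : 0 < x + 1 by rewrite addr_gt0.
  have /(continuous_within_itvP f x10)[H _ _] := cb _ x10.
  by apply: H; rewrite in_itv/= x0 ltrDl/=.
by have /(continuous_within_itvP f ltr01)[_ H _] := cb _ ltr01.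
Qed.

Section Kinf_theory.
Variable R : realType.
Implicit Types f g : R -> R.

Lemma Kinf0 f : Kinf f -> f 0 = 0.
Proof. by case. Qed.

Lemma Kinf_lt f s t : Kinf f -> 0 <= s -> s < t -> f s < f t.
Proof. by case=> _ _ fi _; exact: fi. Qed.

Lemma Kinf_le f s t : Kinf f -> 0 <= s -> s <= t -> f s <= f t.
Proof.
by move=> fK s0; rewrite le_eqVlt => /predU1P[->//|st]; exact/ltW/Kinf_lt.
Qed.

Lemma Kinf_gt0 f s : Kinf f -> 0 < s -> 0 < f s.
Proof. by move=> fK s0; rewrite -(Kinf0 fK); exact: Kinf_lt. Qed.

Lemma Kinf_ge0 f s : Kinf f -> 0 <= s -> 0 <= f s.
Proof. by move=> fK s0; rewrite -(Kinf0 fK); exact: Kinf_le. Qed.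

Lemma Kinf_ltE f s t : Kinf f -> 0 <= s -> 0 <= t -> (f s < f t) = (s < t).
Proof.
move=> fK s0 t0; apply/idP/idP => [|st]; last exact: Kinf_lt.
by apply: contraTT; rewrite -!leNgt; exact: Kinf_le.
Qed.

Lemma Kinf_inj f s t : Kinf f -> 0 <= s -> 0 <= t -> f s = f t -> s = t.
Proof.
move=> fK s0 t0 fst; apply/eqP; rewrite eq_le !leNgt.
by rewrite -(Kinf_ltE fK t0 s0) -(Kinf_ltE fK s0 t0) fst ltxx.
Qed.

Lemma Kinf_ext f g : Kinf f -> (forall s, 0 <= s -> f s = g s) -> Kinf g.
Proof.
move=> /KinfP[f0 fi fs] fg; apply/KinfP; split.
- by rewrite -fg.
- by move=> s t s0 st; rewrite -!fg ?fi// (le_trans s0)// ltW.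
- by move=> y y0; have [x x0 <-] := fs _ y0; exists x; rewrite ?fg.
Qed.

Lemma KinfK f s : Kinf f -> 0 <= s -> Kinv f (f s) = s.
Proof.
move=> fK s0; apply: pinvKV.
  by move=> x y; rewrite !inE/= !in_itv/= !andbT; exact: Kinf_inj.
by rewrite inE/= in_itv/= s0.
Qed.

Lemma KinvK f s : Kinf f -> 0 <= s -> f (Kinv f s) = s.
Proof.
by move=> fK s0; have /KinfP[_ _ /(_ _ s0)[x x0 <-]] := fK; rewrite KinfK.
Qed.

Lemma Kinv_ge0 f s : Kinf f -> 0 <= s -> 0 <= Kinv f s.
Proof.
by move=> fK s0; have /KinfP[_ _ /(_ _ s0)[x x0 <-]] := fK; rewrite KinfK.
Qed.

Lemma Kinf_Kinv f : Kinf f -> Kinf (Kinv f).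
Proof.
move=> fK; apply/KinfP; split.
- by rewrite -[X in Kinv f X](Kinf0 fK) KinfK.
- move=> s t s0 st; have t0 := le_trans s0 (ltW st).
  by rewrite -(Kinf_ltE fK) ?Kinv_ge0// !KinvK.
- by move=> y y0; exists (f y); rewrite ?KinfK// Kinf_ge0.
Qed.

Lemma Kinf_comp f g : Kinf f -> Kinf g -> Kinf (f \o g).
Proof.
move=> fK gK; have /KinfP[f0 _ fs] := fK; have /KinfP[g0 _ gs] := gK.
apply/KinfP; split => /=.
- by rewrite g0.
- by move=> s t s0 st; rewrite !Kinf_lt ?Kinf_ge0.
- move=> y /fs[x x0 <-]; have [z z0 <-] := gs _ x0.
  by exists z.
Qed.

Lemma Kinf_id : Kinf (@id R).
Proof. by apply/KinfP; split => // y y0; exists y. Qed.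

Lemma Kinf_scale c f : 0 < c -> Kinf f -> Kinf (fun s => c * f s).
Proof.
move=> c0 fK; have /KinfP[f0 _ fs] := fK; apply/KinfP; split => /=.
- by rewrite f0 mulr0.
- by move=> s t s0 st; rewrite ltr_pM2l// Kinf_lt.
- move=> y y0; have [|x x0 fx] := fs (c^-1 * y).
    by rewrite mulr_ge0// invr_ge0 ltW.
  by exists x; rewrite // fx mulVKf// gt_eqF.
Qed.

Lemma Kinf_add f g : Kinf f -> Kinf g -> Kinf (fun s => f s + g s).
Proof.
move=> fK gK; have [f0 fc _ fu] := fK; have [g0 gc _ _] := gK; split.
- by rewrite f0 g0 addr0.
- by move=> x; apply: cvgD; [exact: fc|exact: gc].
- by move=> s t s0 st; rewrite ltrD// Kinf_lt.
- move=> M; have [s s0 Ms] := fu M; exists s => //.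
  by rewrite (lt_le_trans Ms)// lerDl Kinf_ge0.
Qed.

Lemma Kinf_max f g : Kinf f -> Kinf g -> Kinf (fun s => Num.max (f s) (g s)).
Proof.
move=> fK gK; apply/KinfP; split.
- by rewrite (Kinf0 fK) (Kinf0 gK) maxxx.
- by move=> s t s0 st; rewrite gt_max !lt_max !Kinf_lt// orbT.
- move=> y y0; have [fy gy] := (Kinv_ge0 fK y0, Kinv_ge0 gK y0).
  (* The inverse of a maximum is the minimum of the inverses. *)
  exists (Num.min (Kinv f y) (Kinv g y)); first by rewrite le_min fy.
  case: (leP (Kinv f y) (Kinv g y)) => [|/ltW] h.
    by rewrite KinvK// max_l// -[leRHS](KinvK gK)// Kinf_le.
  by rewrite [g _]KinvK// max_r// -[leRHS](KinvK fK)// Kinf_le.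
Qed.

Lemma Kinf_min f g : Kinf f -> Kinf g -> Kinf (fun s => Num.min (f s) (g s)).
Proof.
move=> fK gK; apply/KinfP; split.
- by rewrite (Kinf0 fK) (Kinf0 gK) minxx.
- by move=> s t s0 st; rewrite lt_min !gt_min !Kinf_lt// orbT.
- move=> y y0; have [fy gy] := (Kinv_ge0 fK y0, Kinv_ge0 gK y0).
  exists (Num.max (Kinv f y) (Kinv g y)); first by rewrite le_max fy.
  case: (leP (Kinv f y) (Kinv g y)) => [|/ltW] h.
    by rewrite [g _]KinvK// min_r// -[leLHS](KinvK fK)// Kinf_le.
  by rewrite KinvK// min_l// -[leLHS](KinvK gK)// Kinf_le.
Qed.

(** Gains of non-neighbours vanish; this class contains all gains and is closed under composition
    and maximum. *)
Definition Kinf_or_zero f := Kinf f \/ forall s, 0 <= s -> f s = 0.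

Lemma Kinf_or_zero_ge0 f s : Kinf_or_zero f -> 0 <= s -> 0 <= f s.
Proof. by case=> [fK|f0] s0; [exact: Kinf_ge0|rewrite f0]. Qed.

Lemma Kinf_or_zero_le f s t : Kinf_or_zero f -> 0 <= s -> s <= t -> f s <= f t.
Proof.
case=> [fK|f0] s0 st; first exact: Kinf_le.
by rewrite !f0// (le_trans s0).
Qed.

Lemma Kinf_or_zero_comp f g :
  Kinf_or_zero f -> Kinf_or_zero g -> Kinf_or_zero (f \o g).
Proof.
move=> [fK|f0] gK; last by right=> s s0 /=; rewrite f0// Kinf_or_zero_ge0.
case: gK => [gK|g0]; first by left; exact: Kinf_comp.
by right=> s s0 /=; rewrite g0// Kinf0.
Qed.

Lemma Kinf_addr f g : Kinf f -> Kinf_or_zero g -> Kinf (fun s => f s + g s).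
Proof.
move=> fK [gK|g0]; first exact: Kinf_add.
by apply: Kinf_ext fK _ => s s0; rewrite g0// addr0.
Qed.

Lemma Kinf_maxr f g : Kinf f -> Kinf_or_zero g ->
  Kinf (fun s => Num.max (f s) (g s)).
Proof.
move=> fK [gK|g0]; first exact: Kinf_max.
apply: (Kinf_ext fK) => s s0; rewrite g0// max_l//; exact: Kinf_ge0.
Qed.

Lemma Kinf_or_zero_max f g : Kinf_or_zero f -> Kinf_or_zero g ->
  Kinf_or_zero (fun s => Num.max (f s) (g s)).
Proof.
case=> [fK|f0] gK; first by left; exact: Kinf_maxr.
case: gK => [gK|g0].
  by left; apply: (Kinf_ext gK) => s s0; rewrite f0// max_r//; exact: Kinf_ge0.
by right=> s s0; rewrite f0// g0// maxxx.
Qed.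

Lemma Kinf_or_zero_bigmax (I : Type) (r : seq I) (P : pred I)
    (F : I -> R -> R) :
  (forall i, P i -> Kinf_or_zero (F i)) ->
  Kinf_or_zero (fun s => \big[Num.max/0]_(i <- r | P i) F i s).
Proof.
move=> FK; elim: r => [|i r IH]; first by right=> s _; rewrite big_nil.
under eq_fun do rewrite big_cons.
by case Pi: (P i) => //; apply: Kinf_or_zero_max => //; exact: FK.
Qed.

Lemma Kinf_bigmax (I : finType) (F : I -> R -> R) : (0 < #|I|)%N ->
  (forall i, Kinf (F i)) -> Kinf (fun s => \big[Num.max/0]_i F i s).
Proof.
move=> /card_gt0P[i _] FK.
have mK : Kinf_or_zero (fun s => \big[Num.max/0]_i F i s).
  by apply: Kinf_or_zero_bigmax => j _; left.
(* Adjoining the member [F i] to the maximum changes nothing but rules out the zero function. *)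
apply: Kinf_ext (Kinf_maxr (FK i) mK) _ => s s0.
rewrite max_r//; exact: (le_bigmax 0 (F^~ s)).
Qed.

(** Replace the upper bounds by a minorant [m] in [Kinf], still strictly above [lo]; the average of
    [m] and [lo] then lies strictly between. *)
Lemma between_Kinf (J : eqType) (r : seq J) (f : J -> R -> R) (lo : R -> R) :
  Kinf_or_zero lo -> (forall j, j \in r -> Kinf (f j)) ->
  (forall j, j \in r -> fun_lt lo (f j)) ->
  exists2 h, Kinf h & fun_lt lo h /\ forall j, j \in r -> fun_lt h (f j).
Proof.
move=> loK fK lof.
suff [m mK [lom mf]] : exists2 m, Kinf m & fun_lt lo m /\
    forall j, j \in r -> forall s, 0 < s -> m s <= f j s.
  exists (fun s => 2^-1 * (m s + lo s)).
    by apply: Kinf_scale; [rewrite invr_gt0|exact: Kinf_addr].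
  split=> [s s0|j jr s s0]; have := lom s s0; last have := mf j jr s s0; lra.
elim: r fK lof => [_ _|j r IH fK lof].
  (* Without upper bounds any [Kinf] function above [lo] will do. *)
  exists (fun s => s + lo s); first exact: (Kinf_addr Kinf_id loK).
  by split=> // s s0; rewrite ltrDr.
have [||m mK [lom mf]] := IH.
- by move=> i ir; apply: fK; rewrite inE ir orbT.
- by move=> i ir; apply: lof; rewrite inE ir orbT.
exists (fun s => Num.min (f j s) (m s)).
  by apply: Kinf_min => //; apply: fK; exact: mem_head.
split=> [s s0|i]; first by rewrite lt_min lom// andbT lof// mem_head.
rewrite inE => /predU1P[->|ir] s s0; first by rewrite ge_min lexx.
by rewrite ge_min mf ?orbT.
Qed.

End Kinf_theory.

(** * Closed walks and the construction of the [sigma i] *)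

Section small_gain.
Variables (R : realType) (I : eqType).
Implicit Types (g : I -> I -> R -> R) (i j k : I) (p q : seq I).

(** The list [p] omits the start [i], so its size counts edges and the walk is closed when
    [last i p = i]. *)
Fixpoint walk_gain g i p : R -> R :=
  if p is j :: q then g i j \o walk_gain g j q else id.

(** Repeated vertices are allowed because eliminating a node turns a cycle into a walk that may
    cross that node several times. *)
Definition contractive_cycles g := forall i p, p != [::] -> last i p = i ->
  fun_lt (walk_gain g i p) id.

Lemma walk_gain_cat g i p q :
  walk_gain g i (p ++ q) = walk_gain g i p \o walk_gain g (last i p) q.
Proof. by elim: p i => //= j p IH i; rewrite IH. Qed.

Lemma Kinf_or_zero_walk_gain g : (forall i j, Kinf_or_zero (g i j)) ->
  forall i p, Kinf_or_zero (walk_gain g i p).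
Proof.
move=> gK i p; elim: p i => [|j p IH] i /=; first by left; exact: Kinf_id.
exact: Kinf_or_zero_comp.
Qed.

(** A closed walk longer than [n] repeats a vertex. The loop between two visits contracts by
    induction, and so does the walk left after cutting it out; monotonicity combines the two. *)
Lemma contractive_cyclesW g n : (forall i j, Kinf_or_zero (g i j)) ->
  (forall p, uniq p -> (size p <= n)%N) ->
  (forall i p, p != [::] -> last i p = i -> (size p <= n)%N ->
     fun_lt (walk_gain g i p) id) ->
  contractive_cycles g.
Proof.
move=> gK nP gn i p.
have [m] := ubnP (size p); elim: m i p => // m IH i p /ltnSE pm p0 pi s s0.
case: (leqP (size p) n) => [pn|]; first exact: gn.
move=> np; have : ~~ uniq p by apply: contraTN np => /nP; rewrite leqNgt.
move=> /(uniqPn i)[a [b [ab bp abE]]].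
(* The vertex [x] sits at positions [a < b], and [p2] is the loop from the first visit to the
   second. *)
pose x := nth i p a; pose p1 := take a p.
pose p2 := rcons (take (b - a.+1) (drop a.+1 p)) x; pose p3 := drop b.+1 p.
have pE : p = rcons p1 x ++ p2 ++ p3.
  have ap := ltn_trans ab bp.
  rewrite -{1}(cat_take_drop a p) (drop_nth i ap) -cat_rcons; congr (_ ++ _).
  rewrite -{1}(cat_take_drop (b - a.+1) (drop a.+1 p)) drop_drop subnK//.
  by rewrite (drop_nth i bp) -cat_rcons /p2 /x abE.
have lx : last i (rcons p1 x) = x by rewrite last_rcons.
have lx2 : last x p2 = x by rewrite last_rcons.
have wK := Kinf_or_zero_walk_gain gK.
have p20 : p2 != [::] by rewrite -size_eq0 size_rcons.
have q0 : rcons p1 x ++ p3 != [::] by rewrite -size_eq0 size_cat size_rcons.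
have [sp2 sq] : (size p2 < m /\ size (rcons p1 x ++ p3) < m)%N.
  move: pm p20; rewrite pE -size_eq0 !size_cat size_rcons; lia.
have := IH i _ sq q0; rewrite !last_cat lx => IHq.
rewrite pE !walk_gain_cat lx lx2 /=.
apply: (@le_lt_trans _ _ (walk_gain g i (rcons p1 x) (walk_gain g x p3 s))).
  have t0 : 0 <= walk_gain g x p3 s by exact: Kinf_or_zero_ge0 (ltW s0).
  apply: Kinf_or_zero_le => //; first exact: Kinf_or_zero_ge0.
  (* [fun_lt] says nothing at 0, where every walk gain vanishes. *)
  move: t0; rewrite le_eqVlt => /predU1P[<-|t0]; last exact/ltW/IH.
  have [/Kinf0 ->//|->//] := wK x p2.
have {}pi : last x p3 = i by rewrite -[RHS]pi pE !last_cat lx lx2.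
by have := IHq pi s s0; rewrite walk_gain_cat lx.
Qed.

(** At the given [s] each maximum is attained by the direct step or by the detour through [k], so
    [q] depends on [s]. *)
Lemma bypass_walk g k i p s :
  let g' i j s := Num.max (g i j s) (g i k (g k j s)) in
  exists q, [/\ last i q = last i p, (q == [::]) = (p == [::])
    & walk_gain g' i p s = walk_gain g i q s].
Proof.
move=> g'; elim: p i => [|j p IH] i; first by exists [::].
have [q [lq _ wq]] := IH j; rewrite /= wq /g'.
case: (leP (g i j (walk_gain g j q s))) => _; first by exists (k :: j :: q).
by exists (j :: q).
Qed.

(* Fourier-Motzkin elimination of sigma_k: bypassing k replaces the
   gain g i j by the maximum of g i j and g i k \o g k j, and a solution of the
   remaining inequalities leaves room for sigma_k between the g k j \o sigma_j
   and the (g i k)^-1 \o sigma_i. *)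
Lemma small_gain_path g (A : seq I) :
  (forall i j, Kinf_or_zero (g i j)) -> contractive_cycles g ->
  exists2 sigma : I -> R -> R, forall i, Kinf (sigma i) &
    forall i j, i \in A -> j \in A -> fun_lt (g i j \o sigma j) (sigma i).
Proof.
elim: A g => [|k A IH] g gK gC.
  by exists (fun=> id) => // _; exact: Kinf_id.
pose g' i j s := Num.max (g i j s) (g i k (g k j s)).
have [||sg sK sP] := IH g'.
- move=> i j; apply: Kinf_or_zero_max; [exact: gK|].
  by apply: (@Kinf_or_zero_comp _ (g i k)); exact: gK.
- move=> i p p0 pi s s0; have [q [lq q0 ->]] := bypass_walk g k i p s.
  by apply: gC; rewrite ?lq// q0.
have sg0 i s : 0 < s -> 0 < sg i s by move=> s0; exact: Kinf_gt0.
(* The lower bound that the rows [g k j] impose on [sigma k]. *)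
pose lo s := \big[Num.max/0]_(j <- A) g k j (sg j s).
have loK : Kinf_or_zero lo.
  apply: (@Kinf_or_zero_bigmax R I A xpredT (fun j s => g k j (sg j s))) => j _.
  by apply: (@Kinf_or_zero_comp _ (g k j)) => //; left.
have lo_lt i s : i \in A -> 0 < s -> g i k (lo s) < sg i s.
  move=> iA s0; rewrite /lo big_seq.
  apply: (big_ind (fun x => g i k x < sg i s)) => [|x y xs ys|j jA].
  (* The default 0 of the maximum is sent to 0. *)
  - by have [/Kinf0->|->] := gK i k; rewrite ?sg0.
  - by rewrite maxEle; case: ifP.
  - by have := sP _ _ iA jA s s0; rewrite /= /g' gt_max => /andP[].
(* Only an invertible [g i k] bounds [sigma k] from above; a zero gain imposes nothing. *)
pose r := [seq i <- A | `[< Kinf (g i k) >]].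
have rP i : i \in r -> Kinf (g i k) /\ i \in A.
  by rewrite mem_filter => /andP[/asboolP].
have [||h hK [loh hr]] :=
  @between_Kinf R I r (fun i => Kinv (g i k) \o sg i) lo loK.
- by move=> i /rP[giK _]; apply: Kinf_comp => //; exact: Kinf_Kinv.
- move=> i /rP[giK iA] s s0 /=; have sgi := ltW (sg0 i s s0).
  have los : 0 <= lo s by exact: Kinf_or_zero_ge0 loK (ltW s0).
  by rewrite -(Kinf_ltE giK) ?Kinv_ge0// KinvK// lo_lt.
have h0 s : 0 < s -> 0 < h s by move=> s0; exact: Kinf_gt0.
exists (fun i => if i == k then h else sg i); first by move=> i; case: ifP.
have sE i j : i \in A -> j \in A -> fun_lt (g i j \o sg j) (sg i).
  move=> iA jA s s0; have := sP _ _ iA jA s s0.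
  by rewrite /= /g' gt_max => /andP[].
move=> i j; rewrite !inE.
case: eqVneq => [->|ik] /= iA; case: eqVneq => [->|jk] /= jA.
(* The self-loop at [k] is a closed walk of one edge. *)
- by move=> s s0; apply: (gC k [:: k] _ _ (h s) (h0 s s0)).
- move=> s s0 /=; apply: le_lt_trans (loh s s0).
  exact: (le_bigmax_seq 0 j xpredT (fun j => g k j (sg j s))).
- move=> s s0 /=; have [giK|->] := gK i k; [|by rewrite sg0|exact/ltW/h0].
  have ir : i \in r by rewrite mem_filter iA andbT; apply/asboolP.
  have [sgi hs] := (ltW (sg0 i s s0), ltW (h0 s s0)).
  by have := hr i ir s s0; rewrite /= -(Kinf_ltE giK) ?Kinv_ge0// KinvK.
- exact: sE.
Qed.
End small_gain.

(** * The functions and constants attached to the Lyapunov data *)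

Section lyapunov_gains.
Variables (R : realType) (J K : finType) (din : J -> nat) (dout : K -> nat).
Variables (S : switched_system R din dout) (L : lyapunov_data S).

Lemma akappa_lt1 : akappa L < 1.
Proof.
apply: bigmax_lt => // p _; have /andP[k0 k1] := kappap_itv L p.
have e1 := leps_gt1 L.
(* A positive exponent keeps powers of numbers below 1 below 1. *)
have e0 : 0 < (leps L - 1) / leps L.
  by rewrite divr_gt0 ?subr_gt0// (lt_trans _ e1).
by have := gt0_ltr_powR e0 _ _ k1; rewrite powR1 !nnegrE !ltW//; exact.
Qed.

Lemma Kinf_arho : Kinf (arho L).
Proof.
apply: Kinf_bigmax (mode_gt0 S) _ => p.
apply: Kinf_scale; last exact: rhop_Kinf.
by rewrite powR_gt0//; have /andP[] := kappap_itv L p.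
Qed.

Lemma Kinf_agammahat : Kinf (agammahat L).
Proof.
apply: Kinf_bigmax (mode_gt0 S) _ => p.
apply: Kinf_scale; last exact: gammap_Kinf.
by rewrite powR_gt0//; have /andP[] := kappap_itv L p.
Qed.

Lemma Kinf_aalphaup : Kinf (aalphaup L).
Proof. by apply: Kinf_bigmax (mode_gt0 S) _ => p; exact: aup_Kinf. Qed.

Lemma Kinf_aalpha : Kinf (aalpha L).
Proof.
apply: Kinf_Kinv; apply: Kinf_bigmax (mode_gt0 S) _ => p.
apply: (@Kinf_comp _ (ell S)); first exact: ell_Kinf.
by apply: Kinf_Kinv; exact: alow_Kinf.
Qed.

End lyapunov_gains.

(** * Network cycles and the choice of the parameters *)

Lemma cycle_gain_walk (R : realType) (N : nat) (Net : network R N)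
    (L : forall i, lyapunov_data (sub Net i)) i (q : seq 'I_N) :
  cycle_gain L (i :: q) = walk_gain (gain L) i (rcons q i).
Proof.
rewrite /cycle_gain rot1_cons.
(* The closing vertex is separated from the start, which changes along the induction. *)
move: {2 4}i => l; elim: q i => [|j q IH] i /=.
  by rewrite big_cons big_nil.
by rewrite big_cons IH.
Qed.

Theorem theorem24 (R : realType) (N : nat) (N_ge1 : (1 <= N)%N)
    (Net : network R N) (L : forall i, lyapunov_data (sub Net i))
    (Vcal_InitSOPSF : forall i,
       exists (eta0 : R) (phi0 : others i -> R) (prec : R),
         [/\ 0 < eta0, forall j, 0 < phi0 j, 0 <= prec
           & local_InitSOPSF (ts_of (sub Net i))
               (abstraction (sub Net i) eta0 phi0)
               (same_mode (sub Net i)) prec (Vcal (L i))])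
    (small_gain : forall (r : nat) (c : r.-tuple 'I_N), (1 <= r <= N)%N ->
       fun_lt (cycle_gain L c) id)
    (eps : R) (eps_gt0 : 0 < eps) :
  exists (sigma : 'I_N -> R -> R) (r : R),
    [/\ forall i, Kinf (sigma i),
        forall i, fun_lt
          (fun s => \big[Num.max/0]_(j | nbr Net i j) gain L i j (sigma j s))
          (sigma i),
        0 < r,
        \big[Num.max/0]_i sigma i r = eps
      & let e := fun i => sigma i r in
        exists phi : 'I_N -> 'I_N -> R,
          [/\ forall i j, j != i -> 0 < phi i j,
              forall i, \big[Num.max/0]_(j | nbr Net i j) phi i j <
                Kinv (arho (L i)) ((1 - akappa (L i)) * e i)
                - \big[Num.max/0]_(j | nbr Net i j) Kinv (aalpha (L j)) (e j)
            & let theta := fun i => \big[Num.max/0]_(j | nbr Net i j)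
                (Kinv (aalpha (L j)) (e j) + phi i j) in
              exists eta : 'I_N -> R,
                [/\ forall i, 0 < eta i,
                    forall i j, nbr Net i j ->
                      Kinv (aalpha (L j)) (e j) + phi i j <= theta i
                  & forall i, eta i <= Num.min
                      (Kinv (agammahat (L i))
                        ((1 - akappa (L i)) * e i - arho (L i) (theta i)))
                      (Kinv (aalphaup (L i)) (e i))]]].
Proof.
have rK i := Kinf_arho (L i).
have aK i := Kinf_Kinv (Kinf_aalpha (L i)).
have k1 i : 0 < 1 - akappa (L i) by rewrite subr_gt0 akappa_lt1.
have gK i j : Kinf_or_zero (gain L i j).
  rewrite /gain; case: ifP => _; last by right.
  left; apply: Kinf_scale; first by rewrite invr_gt0.
  exact: (@Kinf_comp _ (arho (L i))).
have gC : contractive_cycles (gain L).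
  apply: (contractive_cyclesW (n := N)) => //.
    move=> p up; rewrite -[N in (_ <= N)%N]card_ord -(card_uniqP up).
    exact: max_card.
  move=> i p; case: (lastP p) => // q x _.
  (* A nonempty closed walk ends with its start, hence comes from the cycle [i :: q]. *)
  rewrite last_rcons size_rcons => -> qN.
  rewrite -cycle_gain_walk.
  exact: (small_gain (size (i :: q)) (in_tuple (i :: q))).
have [sigma sK sP] := small_gain_path (enum 'I_N) gK gC.
set m := fun s => \big[Num.max/0]_i sigma i s.
have mK : Kinf m.
  by apply: Kinf_bigmax; rewrite ?card_ord.
pose r := Kinv m eps; exists sigma, r.
have r0 : 0 < r by apply: Kinf_gt0 => //; exact: Kinf_Kinv.
have gP i j s : 0 < s -> gain L i j (sigma j s) < sigma i s.
  by apply: sP; rewrite mem_enum.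
have s0 i : 0 < sigma i r by exact: Kinf_gt0.
split=> //.
- by move=> i s sgt0; apply: bigmax_lt => [|j _]; [exact: Kinf_gt0|exact: gP].
- by apply: KinvK mK (ltW eps_gt0).
move=> e.
pose B i := Kinv (arho (L i)) ((1 - akappa (L i)) * e i).
pose M i := \big[Num.max/0]_(j | nbr Net i j) Kinv (aalpha (L j)) (e j).
have ke i : 0 < (1 - akappa (L i)) * e i by exact: mulr_gt0 (k1 i) (s0 i).
have B0 i : 0 < B i by exact: Kinf_gt0 (Kinf_Kinv (rK i)) (ke i).
(* Positivity of [B i] covers a node without neighbours; otherwise the gain inequality at [r] is
   multiplied by [1 - akappa (L i)] and [arho (L i)] is inverted. *)
have MB i : M i < B i.
  apply: bigmax_lt => // j ij.
  have ej0 : 0 <= Kinv (aalpha (L j)) (e j).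
    by exact: ltW (Kinf_gt0 (aK j) (s0 j)).
  rewrite -(Kinf_ltE (rK i) ej0 (ltW (B0 i))) KinvK ?ltW//.
  by have := gP i j r r0; rewrite /gain ij ltr_pdivrMl.
(* Half the gap keeps [theta i] strictly below [B i]. *)
have phi0 i : 0 < (B i - M i) / 2 by rewrite divr_gt0 ?subr_gt0.
exists (fun i _ => (B i - M i) / 2); split=> [//|i|theta].
  have := MB i; rewrite -/(B i) -/(M i) => MBi.
  apply: bigmax_lt => [|j _]; first by rewrite subr_gt0.
  lra.
have theta_ge0 i : 0 <= theta i by exact: bigmax_ge_id.
have thetaB i : theta i < B i.
  apply: bigmax_lt => // j ij; have := MB i.
  have : Kinv (aalpha (L j)) (e j) <= M i by exact: le_bigmax_cond.
  lra.
exists (fun i => Num.min (Kinv (agammahat (L i))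
    ((1 - akappa (L i)) * e i - arho (L i) (theta i)))
  (Kinv (aalphaup (L i)) (e i))); split=> [i|i j ij|i//].
  rewrite lt_min; apply/andP; split; apply: Kinf_gt0.
  - exact: Kinf_Kinv (Kinf_agammahat _).
  (* Applying [arho (L i)] to [theta i < B i] makes the argument of the inverse positive. *)
  - rewrite subr_gt0 -[ltRHS](KinvK (rK i)) ?ltW//.
    by rewrite (Kinf_ltE (rK i)) ?(ltW (B0 i)).
  - exact: Kinf_Kinv (Kinf_aalphaup _).
  - exact: s0.
exact: le_bigmax_cond.
Qed.
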